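(* For a non-trivial commutative ring with unit $A$, the following are equivalent: (1) $A$ is an algebraically closed field; (2) for every $n\in\mathbb N$ and every ideal $I$ of $A[X_1,\dots,X_n]$, $\mathscr I(\mathscr Z_A(I))=\sqrt I$; (3) for every $n\in\mathbb N$ and every finitely generated ideal $I$ of $A[X_1,\dots,X_n]$, $\mathscr I(\mathscr Z_A(I))=\sqrt I$; (4) $A$ is positively existentially closed in the class of non-trivial rings.
   Context: $\mathscr Z_A(I)=\{\bar a\in A^n:P(\bar a)=0\ \forall P\in I\}$; $\mathscr I(S)=\{P: P(\bar a)=0\ \forall\bar a\in S\}$; $\sqrt I$ is the usual radical. Rings are commutative with unit, in the language $\langle+,-,\times,0,1\rangle$; $A$ is positively existentially closed in the class of non-trivial rings if every ring homomorphism $f:A\to B$ into a non-trivial ring $B$ is an immersion, i.e. for every positive existential sentence $\phi(\bar a)$ (a prenex existential formula without negation) with parameters in $A$, $B\models\phi(f\bar a)$ implies $A\models\phi(\bar a)$. *)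

(* Defs.v *)
From HB Require Import structures.
From mathcomp Require Import all_boot all_order all_algebra.
From mathcomp Require Import mpoly.
Set Implicit Arguments. Unset Strict Implicit. Unset Printing Implicit Defensive.
Import Order.TTheory GRing.Theory.
Local Open Scope ring_scope.

(* Rings are commutative with unit; "non-trivial" = comNzRingType (1 != 0). *)

Definition is_field (A : comNzRingType) : Prop :=
  forall x : A, x != 0 -> exists y : A, x * y = 1.

Definition alg_closed (A : comNzRingType) : Prop :=
  forall p : {poly A}, (1 < size p)%N -> exists x : A, root p x.

Definition alg_closed_field (A : comNzRingType) : Prop :=
  is_field A /\ alg_closed A.

Definition is_ideal (R : comNzRingType) (I : R -> Prop) : Prop :=
  [/\ I 0, (forall x y, I x -> I y -> I (x + y))
    & (forall a x, I x -> I (a * x))].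

Definition fin_gen_ideal (R : comNzRingType) (I : R -> Prop) : Prop :=
  exists s : seq R, forall x : R,
    I x <-> exists c : 'I_(size s) -> R, x = \sum_(i < size s) c i * s`_i.

Definition zeroset (A : comNzRingType) (n : nat) (I : {mpoly A[n]} -> Prop)
  : ('I_n -> A) -> Prop :=
  fun a => forall P, I P -> P.@[a] = 0.

Definition vanish_ideal (A : comNzRingType) (n : nat) (S : ('I_n -> A) -> Prop)
  : {mpoly A[n]} -> Prop :=
  fun P => forall a, S a -> P.@[a] = 0.

Definition radical (R : comNzRingType) (I : R -> Prop) : R -> Prop :=
  fun x => exists k : nat, I (x ^+ k).

Definition nullstellensatz_for (A : comNzRingType) (n : nat)
  (I : {mpoly A[n]} -> Prop) : Prop :=
  forall P, vanish_ideal (zeroset I) P <-> radical I P.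

Inductive pterm (C : Type) (k : nat) : Type :=
  | PVar of 'I_k
  | PConst of C
  | PZero
  | POne
  | PAdd of pterm C k & pterm C k
  | PSub of pterm C k & pterm C k
  | PMul of pterm C k & pterm C k.

Inductive pform (C : Type) (k : nat) : Type :=
  | PTrue
  | PFalse
  | PEq of pterm C k & pterm C k
  | PAnd of pform C k & pform C k
  | POr of pform C k & pform C k.

Fixpoint eval_pterm (C : Type) (B : comNzRingType) (f : C -> B) (k : nat)
  (e : 'I_k -> B) (t : pterm C k) : B :=
  match t with
  | PVar i => e i
  | PConst c => f c
  | PZero => 0
  | POne => 1
  | PAdd t1 t2 => eval_pterm f e t1 + eval_pterm f e t2
  | PSub t1 t2 => eval_pterm f e t1 - eval_pterm f e t2
  | PMul t1 t2 => eval_pterm f e t1 * eval_pterm f e t2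
  end.

Fixpoint holds_pform (C : Type) (B : comNzRingType) (f : C -> B) (k : nat)
  (e : 'I_k -> B) (phi : pform C k) : Prop :=
  match phi with
  | PTrue => True
  | PFalse => False
  | PEq t1 t2 => eval_pterm f e t1 = eval_pterm f e t2
  | PAnd p1 p2 => holds_pform f e p1 /\ holds_pform f e p2
  | POr p1 p2 => holds_pform f e p1 \/ holds_pform f e p2
  end.

(* The positive existential sentence  exists x_0 ... x_{k-1}, phi(x, abar)
   (parameters abar in A, occurring as constants) holds in B, parameters
   being sent to B via f. *)
Definition sat_pex (A B : comNzRingType) (f : A -> B) (k : nat)
  (phi : pform A k) : Prop :=
  exists e : 'I_k -> B, holds_pform f e phi.

Definition immersion (A B : comNzRingType) (f : {rmorphism A -> B}) : Prop :=
  forall (k : nat) (phi : pform A k), sat_pex f phi -> sat_pex idfun phi.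

Definition pec_nontrivial (A : comNzRingType) : Prop :=
  forall (B : comNzRingType) (f : {rmorphism A -> B}), immersion f.

(* Main.v *)
(* (1) => (2) rests on a specialization property of a prime [p] of [R[X]] lying
   over the prime [q] of [R]: for [g] outside [p] there is [c] in [R] outside
   [q] such that every morphism from [R] to an algebraically closed field which
   kills [q] but not [c] extends to [R[X]], killing [p] but not [g]. By
   induction on the number of variables, for every prime [p] and every [g]
   outside it some point of the zero set of [p] is not a zero of [g]; if [g] is
   not in the radical of [I], such a [p] containing [I] is provided by Zorn's
   lemma.
   (3) => (4): a positive existential sentence true in [B] yields a finite system
   of polynomial equations over [A] with a solution in [B]; without a solution
   in [A], the system generates the unit ideal, so that [1 = 0] in [B].
   (4) => (1): apply (4) to the sentence [x = 0] in [A / (x)] for a non-unit [x],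
   and then to [exists x, P(x) = 0] in [A[X] / (P)]. *)
Require Import Defs.
From HB Require Import structures.
From mathcomp Require Import all_boot all_order all_algebra.
From mathcomp Require Import mpoly.
From mathcomp Require Import boolp classical_sets.
From mathcomp Require Import ring.
Set Implicit Arguments.
Unset Strict Implicit.
Unset Printing Implicit Defensive.
Import GRing.Theory.
Local Open Scope ring_scope.

(** * Ideals, primes avoiding an element, and quotient rings *)

Section Ideals.

Variable R : comNzRingType.
Implicit Types (I : R -> Prop) (x y : R).

Lemma idealN I x : is_ideal I -> I x -> I (- x).
Proof. by case=> _ _ IM Ix; rewrite -mulN1r; apply: IM. Qed.

Lemma idealB I x y : is_ideal I -> I x -> I y -> I (x - y).
Proof.
by move=> idI Ix Iy; case: (idI) => _ ID _; apply: ID => //; apply: idealN.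
Qed.

Lemma ideal_sum I (J : Type) (r : seq J) (F : J -> R) :
  is_ideal I -> (forall j, I (F j)) -> I (\sum_(j <- r) F j).
Proof. by case=> I0 ID _ IF; elim/big_ind: _. Qed.

Lemma ideal_modl I x y : is_ideal I -> I (x - y) -> I y -> I x.
Proof. by case=> _ ID _ Ixy Iy; rewrite -(subrK y x); apply: ID. Qed.

Definition prime_ideal I : Prop :=
  [/\ is_ideal I, ~ I 1 & forall x y, I (x * y) -> I x \/ I y].

Lemma prime_idealX I x k : prime_ideal I -> I (x ^+ k) -> I x.
Proof.
case=> _ nI1 pI; elim: k => [|k IHk]; first by rewrite expr0.
by rewrite exprS => /pI[].
Qed.

Definition ideal_adjoin I x : R -> Prop := fun y => exists u, I (y - u * x).

Lemma ideal_adjoinP I x : is_ideal I -> is_ideal (ideal_adjoin I x).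
Proof.
move=> idI; case: (idI) => I0 ID IM; split.
- by exists 0; rewrite mul0r subrr.
- move=> y z [u Iu] [v Iv]; exists (u + v).
  by rewrite mulrDl opprD addrACA; apply: ID.
- move=> a y [u Iu]; exists (a * u); rewrite -mulrA -mulrBr; exact: IM.
Qed.

Lemma sub_ideal_adjoin I x y : I y -> ideal_adjoin I x y.
Proof. by exists 0; rewrite mul0r subr0. Qed.

Lemma mem_ideal_adjoin I x : is_ideal I -> ideal_adjoin I x x.
Proof. by case=> I0 _ _; exists 1; rewrite mul1r subrr. Qed.

(* The property handed to Zorn's lemma is about [I `|` J] because the union of
   the empty chain is empty, hence not an ideal. *)
Lemma exists_prime_avoiding I x : is_ideal I -> ~ radical I x ->
  exists p, [/\ prime_ideal p, forall y, I y -> p y & ~ p x].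
Proof.
move=> idI nIx; case: (idI) => I0 ID IM.
pose Q (J : set R) :=
  is_ideal (I `|` J)%classic /\ ~ radical (I `|` J)%classic x.
have [|J [[idJ nJx] maxJ]] := @Zorn_bigcup R Q.
  move=> F FQ totF; split; last first.
    case=> k [Ik|[X FX Xk]]; first by apply: nIx; exists k.
    by case: (FQ _ FX) => _; apply; exists k; right.
  split; first by left.
  - move=> y z [Iy|[X FX Xy]] [Iz|[Y FY Yz]].
    + by left; apply: ID.
    + have [[_ D _] _] := FQ _ FY.
      by case: (D y z (or_introl Iy) (or_intror Yz)); [left|right; exists Y].
    + have [[_ D _] _] := FQ _ FX.
      by case: (D y z (or_intror Xy) (or_introl Iz)); [left|right; exists X].
    + case: (totF _ _ FX FY) => [XY|YX].
        have [[_ D _] _] := FQ _ FY.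
        case: (D y z (or_intror (XY _ Xy)) (or_intror Yz)); first by left.
        by right; exists Y.
      have [[_ D _] _] := FQ _ FX.
      case: (D y z (or_intror Xy) (or_intror (YX _ Yz))); first by left.
      by right; exists X.
  - move=> a y [Iy|[X FX Xy]]; first by left; apply: IM.
    have [[_ _ M] _] := FQ _ FX.
    by case: (M a y (or_intror Xy)); [left|right; exists X].
set p := (I `|` J)%classic in idJ nJx *.
have [p0 pD pM] := idJ.
(* By maximality of [J], an ideal properly containing [p] contains a power of [x]. *)
have adj_rad y : ~ p y -> radical (ideal_adjoin p y) x.
  move=> npy; apply: contrapT => nrad.
  have Ip z : I z -> ideal_adjoin p y z.
    by move=> Iz; apply: sub_ideal_adjoin; left.
  apply: (maxJ (ideal_adjoin p y)).
    split; first by move=> z Jz; apply: sub_ideal_adjoin; right.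
    by move=> /(_ y (mem_ideal_adjoin y idJ)) Jy; apply: npy; right.
  rewrite /Q; have -> : (I `|` ideal_adjoin p y)%classic = ideal_adjoin p y.
    by apply/seteqP; split=> [z [/Ip|]|z] //; right.
  by split=> //; apply: ideal_adjoinP.
exists p; split; last by move=> px; apply: nJx; exists 1%N.
  split=> //; first by move=> p1; apply: nJx; exists 0%N.
  move=> y z pyz; apply: contrapT => npyz.
  have [[i [u pu]] [j [v pv]]] : radical (ideal_adjoin p y) x /\
      radical (ideal_adjoin p z) x.
    by split; apply: adj_rad => ?; apply: npyz; [left|right].
  apply: nJx; exists (i + j)%N; rewrite exprD.
  (* Modulo [p], the two powers of [x] are [u * y] and [v * z], and [y * z] lies in [p]. *)
  have -> : x ^+ i * x ^+ j = (x ^+ j) * (x ^+ i - u * y)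
      + (u * y) * (x ^+ j - v * z) + (u * v) * (y * z).
    by ring.
  by apply: (pD); [apply: (pD)|]; apply: (pM).
by move=> y; left.
Qed.

Lemma exists_quotient_ring I : is_ideal I -> ~ I 1 ->
  exists (B : comNzRingType) (f : {rmorphism R -> B}), forall x, I x -> f x = 0.
Proof.
move=> idI nI1; pose S : R -> bool := fun x => `[< I x >].
(* [idealr_closed] also asks that 1 be outside [S], which makes the quotient non-trivial. *)
have S_idealr : idealr_closed S.
  case: (idI) => I0 ID IM; split; first exact/asboolP.
    exact/asboolPn.
  by move=> a u v /asboolP Iu /asboolP Iv; apply/asboolP/ID/Iv/IM.
pose mS := isIdealr.Build R S S_idealr.
pose T : idealr R := HB.pack S mS.
exists {ideal_quot T}, (\pi_{ideal_quot T}%qT) => x Ix.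
apply/eqP; rewrite -(rmorph0 (\pi_{ideal_quot T}%qT)) -Quotient.idealrBE subr0.
exact/asboolP.
Qed.

End Ideals.

(** * Rings whose nonzero elements are invertible *)

Section FieldLike.

Variable K : comNzRingType.
Hypothesis fieldK : is_field K.

Lemma is_field_mulf_neq0 (x y : K) : x != 0 -> y != 0 -> x * y != 0.
Proof.
move=> /fieldK[x' xx'] y0; apply: contra_neq y0 => xy0.
by rewrite -[y]mul1r -xx' mulrAC xy0 mul0r.
Qed.

Lemma is_field_expf_neq0 (x : K) k : x != 0 -> x ^+ k != 0.
Proof.
move=> x0; elim: k => [|k IHk]; first by rewrite expr0 oner_neq0.
by rewrite exprS is_field_mulf_neq0.
Qed.

(* A root of [p - 1] serves when [p] is not constant. *)
Lemma alg_closed_nonroot (p : {poly K}) : alg_closed K -> p != 0 ->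
  exists x, p.[x] != 0.
Proof.
move=> acK p0; have [sp|sp] := ltnP 1 (size p).
  have [|x] := acK (p - 1).
    by rewrite size_polyDl // size_polyN size_poly1.
  rewrite rootE hornerD hornerN hornerC subr_eq0 => /eqP px.
  by exists x; rewrite px oner_neq0.
exists 0; rewrite horner_coef0; move: p0.
by rewrite [in p != 0](size1_polyC sp) polyC_eq0.
Qed.

End FieldLike.

Lemma polyC_lead_coef (R : nzRingType) (f : {poly R}) :
  (size f <= 1)%N -> (lead_coef f)%:P = f.
Proof. by move/size1_polyC => ->; rewrite lead_coefC. Qed.

(** * Specialization of a prime of [R[X]] *)

Section Specialization.

Variables (R : comNzRingType) (p : {poly R} -> Prop).
Hypothesis prime_p : prime_ideal p.
Implicit Types f g h : {poly R}.

Let ideal_p : is_ideal p. Proof. by case: prime_p. Qed.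

(** The prime of [R] that [p] lies over. *)
Let q : R -> Prop := fun c => p c%:P.

Let ideal_q : is_ideal q.
Proof.
case: ideal_p => p0 pD pM; split; rewrite /q //.
- by move=> x y px py; rewrite polyCD; apply: pD.
- by move=> a x px; rewrite polyCM; apply: pM.
Qed.

Let prime_q : prime_ideal q.
Proof.
case: prime_p => _ np1 pP; split=> // x y; rewrite /q polyCM; exact: pP.
Qed.

(* [Z] is [q R[X]]: computing modulo [Z] takes the place of working with
   polynomials over the fraction field of [R / q]. *)
Let Z (f : {poly R}) : Prop := forall i, q f`_i.

Let Z_p f : Z f -> p f.
Proof.
move=> Zf; rewrite -[f]coefK poly_def; apply: ideal_sum => // i.
by rewrite -mul_polyC mulrC; case: ideal_p => _ _ pM; apply: pM; apply: Zf.
Qed.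

Let ideal_Z : is_ideal Z.
Proof.
have [q0 qD qM] := ideal_q; split.
- by move=> i; rewrite coef0.
- by move=> f g Zf Zg i; rewrite coefD; apply: qD.
- by move=> f g Zg i; rewrite coefM; apply: ideal_sum => // j; apply: qM.
Qed.

Let Z_CXn c n : q c -> Z (c *: 'X^n).
Proof.
by move=> qc i; rewrite coefZ mulrC; case: ideal_q => _ _ qM; apply: qM.
Qed.

Let Z_size (f : {poly R}) n : (size f <= n.+1)%N -> q f`_n ->
  exists2 g : {poly R}, Z (f - g) & (size g <= n)%N.
Proof.
move=> sf qf; exists (f - f`_n *: 'X^n).
  by rewrite subKr; apply: Z_CXn.
apply/leq_sizeP => j; rewrite leq_eqVlt => /predU1P[<-|ltnj].
  by rewrite coefB coefZ coefXn eqxx mulr1 subrr.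
rewrite coefB coefZ coefXn gtn_eqF // mulr0 subr0.
by rewrite nth_default // (leq_trans sf).
Qed.

(** Leading terms with coefficient in [q] are dropped one by one. This stops before 0, since some
    coefficient of [f] lies outside [q]. *)
Let trim f : ~ Z f -> exists2 g, Z (f - g) & ~ q (lead_coef g).
Proof.
move: {2}(size f) (leqnn (size f)) => n; elim: n f => [|n IHn] f sf nZf.
  move: sf; rewrite leqn0 size_poly_eq0 => /eqP f0.
  by case: nZf; rewrite f0; case: ideal_Z.
have [qf|nqf] := EM (q f`_n).
  have [g Zfg sg] := Z_size sf qf.
  have [|h Zgh nqh] := IHn g sg.
    by move=> Zg; apply: nZf; apply: ideal_modl Zfg Zg.
  exists h => //; rewrite -[f](subrK g) -addrA.
  by case: ideal_Z => _ ZD _; apply: ZD.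
exists f; first by rewrite subrr; case: ideal_Z.
rewrite lead_coefE; suff -> : size f = n.+1 by [].
apply/eqP; rewrite eqn_leq sf ltnNge; apply/negP => sfn.
by apply: nqf; rewrite nth_default //; case: ideal_q.
Qed.

(** Take [h] of least size in [M] outside [Z]: were its leading coefficient in [q], dropping the
    leading term would give a smaller one. Over the fraction field of [R / q], [h] generates [M]. *)
Let minimal (M : {poly R} -> Prop) f0 : is_ideal M -> (forall f, Z f -> M f) ->
  M f0 -> ~ Z f0 -> exists h, [/\ M h, ~ q (lead_coef h)
    & forall f, M f -> (size f < size h)%N -> Z f].
Proof.
move=> idM ZM Mf0 nZf0.
pose S n := `[< exists f, [/\ M f, ~ Z f & size f = n] >].
have exS : exists n, S n by exists (size f0); apply/asboolP; exists f0.
case: (ex_minnP exS) => n /asboolP[h [Mh nZh sh]] minn.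
have small f : M f -> (size f < size h)%N -> Z f.
  move=> Mf; rewrite ltnNge => /negP sfh; apply: contrapT => nZf; apply: sfh.
  by rewrite sh; apply: minn; apply/asboolP; exists f.
exists h; split=> // ql; apply: nZh.
case eh : (size h) => [|m].
  by move/eqP: eh; rewrite size_poly_eq0 => /eqP->; case: ideal_Z.
have sm : (size h <= m.+1)%N by rewrite eh.
have [|g Zhg sg] := Z_size sm; first by move: ql; rewrite lead_coefE eh.
apply: (ideal_modl ideal_Z Zhg); apply: small; last by rewrite eh.
rewrite -[g](subKr h); apply: idealB => //; exact: ZM.
Qed.

Let q_lead_neq0 f : ~ q (lead_coef f) -> f != 0.
Proof.
move=> nql; apply/eqP => f0; apply: nql.
by rewrite f0 lead_coef0; case: ideal_q.
Qed.

(** The remainder of the pseudo-division of [f] by [h] is in [M] and smaller than [h], hence in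
    [Z]. *)
Let pseudo_div (M : {poly R} -> Prop) h f : is_ideal M -> M h ->
  ~ q (lead_coef h) -> (forall f, M f -> (size f < size h)%N -> Z f) -> M f ->
  exists k Q, Z (lead_coef h ^+ k *: f - Q * h).
Proof.
move=> idM Mh nql small Mf; have [_ _ MM] := idM.
exists (Pdiv.Ring.rscalp f h), (Pdiv.Ring.rdivp f h).
have E := Pdiv.ComRing.rdivp_eq h f.
apply: small.
  by apply: idealB => //; rewrite -?mul_polyC; apply: MM.
by rewrite E addrC addKr Pdiv.Ring.ltn_rmodpN0 // q_lead_neq0.
Qed.

(* Over the fraction field of [R / q] this says that an element outside the
   maximal ideal generated by [p] is invertible modulo it. *)
Let inverse_mod f0 g : p f0 -> ~ Z f0 -> ~ p g ->
  exists u c, ~ q c /\ p (c%:P - u * g).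
Proof.
move=> pf0 nZf0 npg.
have [h [ph nqh minh]] := minimal ideal_p Z_p pf0 nZf0.
pose M := ideal_adjoin p g.
have idM : is_ideal M by apply: ideal_adjoinP.
have pM f : p f -> M f by apply: sub_ideal_adjoin.
(* [s] plays the role of a gcd of [h] and [g]. If it is constant, it is the required [c]; the rest
   of the proof refutes the other case. *)
have [s [Ms nqs mins]] : exists s, [/\ M s, ~ q (lead_coef s)
    & forall f, M f -> (size f < size s)%N -> Z f].
  by apply: (minimal (f0 := f0)) => // [f /Z_p|]; apply: pM.
have Mg : M g by apply: mem_ideal_adjoin.
have [ss|ss] := leqP (size s) 1.
  case: (Ms) => u pu; exists u, (lead_coef s); split=> //.
  by rewrite polyC_lead_coef.
(* Modulo [Z] and up to a factor outside [q], [s] divides [g], so [p s] would give [p g]. *)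
have nps : ~ p s.
  move=> ps; have [k [Q Zg]] := pseudo_div idM Ms nqs mins Mg.
  have : p (lead_coef s ^+ k *: g).
    apply: (ideal_modl ideal_p (Z_p Zg)).
    by case: ideal_p => _ _; apply.
  rewrite -mul_polyC; case: prime_p => _ _ pP /pP[] //.
  by rewrite -/(q _) => /(prime_idealX prime_q).
(* Likewise [s] divides [h]. As [s] is outside the prime [p], the cofactor [Q] is in [p], and
   minimality of [h] forbids it to have smaller degree than [h] modulo [Z]. *)
have [k [Q Zh]] := pseudo_div idM Ms nqs mins (pM _ ph).
have pQ : p Q.
  case: prime_p => _ _ pP.
  suff /pP[] : p (Q * s) by [].
  rewrite -[Q * s](subKr (lead_coef s ^+ k *: h)); apply: idealB => //.
    by rewrite -mul_polyC; case: ideal_p => _ _; apply.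
  exact: Z_p.
have nZQ : ~ Z Q.
  move=> ZQ; have : Z (lead_coef s ^+ k *: h).
    apply: (ideal_modl ideal_Z Zh); rewrite mulrC.
    by case: ideal_Z => _ _; apply.
  move=> /(_ (size h).-1); rewrite coefZ -lead_coefE.
  by case: prime_q => _ _ qP /qP[] // /(prime_idealX prime_q).
have [Q' ZQ nqQ] := trim nZQ.
have pQ' : p Q'.
  by rewrite -[Q'](subKr Q); apply: idealB => //; apply: Z_p.
have sQ : (size h <= size Q')%N.
  rewrite leqNgt; apply/negP => /(minh _ pQ') /(_ (size Q').-1).
  by rewrite -lead_coefE.
have Zd : Z (lead_coef s ^+ k *: h - Q' * s).
  have -> : lead_coef s ^+ k *: h - Q' * s
    = (lead_coef s ^+ k *: h - Q * s) + s * (Q - Q') by ring.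
  by case: ideal_Z => _ ZD ZM; apply: ZD => //; apply: ZM.
(* This index is the formal degree of [Q' * s]. It is at least [size h] because [s] is not constant,
   so [h] contributes 0 and [q] would contain a product of two elements outside it. *)
have := Zd (size Q' + size s).-2.
rewrite coefB coefZ [h`__]nth_default; last first.
  case: (size s) ss => [|[|b]] // _.
  by rewrite !addnS /= (leq_trans sQ) ?leq_addr.
rewrite mulr0 sub0r => /(idealN ideal_q); rewrite opprK.
rewrite -mul_lead_coef.
by case: prime_q => _ _ qP /qP[].
Qed.

Lemma prime_poly_specialization g : ~ p g -> exists2 c : R, ~ p c%:P &
  forall (K : comNzRingType) (phi : {rmorphism R -> K}), alg_closed_field K ->
    (forall x, p x%:P -> phi x = 0) -> phi c != 0 ->
  exists2 xi : K, forall f, p f -> (map_poly phi f).[xi] = 0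
                & (map_poly phi g).[xi] != 0.
Proof.
move=> npg.
(* If [p] reduces to [Z], every point is a zero of the image of [p], and [xi] need only avoid the
   roots of the image of [g]. *)
have [pZ|/existsNP[f0 /not_implyP[pf0 nZf0]]] := EM (forall f, p f -> Z f).
  have /existsNP[i nqi] : ~ Z g by move/Z_p.
  exists g`_i => // K phi [fK aK] phiq phic.
  have phig : map_poly phi g != 0.
    by apply: contra_neq phic => phig; rewrite -coef_map phig coef0.
  have [xi gxi] := alg_closed_nonroot aK phig; exists xi => // f /pZ Zf.
  suff -> : map_poly phi f = 0 by rewrite horner0.
  by apply/polyP => j; rewrite coef_map coef0; apply: phiq; apply: Zf.
have [u [c [nqc puc]]] := inverse_mod pf0 nZf0 npg.
have [h [ph nqh minh]] := minimal ideal_p Z_p pf0 nZf0.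
(* The factor [lead_coef h] keeps the image of [h] non-constant, so that it has a root [xi]; the
   factor [c], a multiple of [g] modulo [p], keeps the image of [g] nonzero at [xi]. *)
exists (lead_coef h * c).
  by case: prime_q => _ _ qP /qP[].
move=> K phi [fK aK] phiq; rewrite rmorphM => phihc.
have phih : phi (lead_coef h) != 0.
  by apply: contra_neq phihc => ->; rewrite mul0r.
have phic : phi c != 0 by apply: contra_neq phihc => ->; rewrite mulr0.
have sh : (1 < size h)%N.
  rewrite ltnNge; apply/negP => sh; apply: nqh.
  by rewrite /q polyC_lead_coef.
have [|xi] := aK (map_poly phi h); first by rewrite size_map_poly_id0.
move=> /rootP hxi.
have pxi f : p f -> (map_poly phi f).[xi] = 0.
  move=> pf; have [k [Q Zf]] := pseudo_div ideal_p ph nqh minh pf.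
  have /(congr1 (fun r => r.[xi])) :
      map_poly phi (lead_coef h ^+ k *: f - Q * h) = 0.
    by apply/polyP => j; rewrite coef_map coef0; apply: phiq; apply: Zf.
  rewrite rmorphB rmorphM /= map_polyZ hornerD hornerN hornerZ hornerM hxi.
  rewrite mulr0 subr0 horner0 rmorphXn => E.
  apply: contra_eq E => fxi.
  by rewrite is_field_mulf_neq0 // is_field_expf_neq0.
exists xi => //.
have := pxi _ puc; rewrite rmorphB rmorphM /= map_polyC hornerD hornerN hornerM.
rewrite hornerC => /eqP; rewrite subr_eq0 => /eqP E.
by apply: contra_neq phic => gxi; rewrite E gxi mulr0.
Qed.

End Specialization.

(** * The Nullstellensatz over an algebraically closed field *)

Section Nullstellensatz.

Variable A : comNzRingType.

Section AdjoinVariable.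

Variable n : nat.

(* The isomorphism [A[X_1, ..., X_n][T] -> A[X_1, ..., X_n, T]]. *)
Definition mpoly_adjoin : {rmorphism {poly {mpoly A[n]}} -> {mpoly A[n.+1]}} :=
  horner_eval 'X_ord_max \o map_poly (@mwiden n A).

Let adjoinC c : mpoly_adjoin c%:P = mwiden c.
Proof. by rewrite /= map_polyC /horner_eval hornerC. Qed.

Let adjoinX : mpoly_adjoin 'X = 'X_ord_max.
Proof. by rewrite /= map_polyX /horner_eval hornerX. Qed.

Let adjoin_var i : exists h, mpoly_adjoin h = 'X_i.
Proof.
case: (unliftP ord_max i) => [j ->|->]; last by exists 'X; apply: adjoinX.
exists ('X_j)%:P; rewrite adjoinC mwidenX mnmwiden1; congr 'X_[U_(_)].
by apply: val_inj; rewrite /= /bump leqNgt ltn_ord.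
Qed.

Lemma mpoly_adjoin_surj (P : {mpoly A[n.+1]}) :
  exists h, mpoly_adjoin h = P.
Proof.
elim/mpolyind: P => [|c m P _ _ [h <-]]; first by exists 0; apply: rmorph0.
have [g Eg] : exists g, mpoly_adjoin g = 'X_[m].
  rewrite mpolyXE_id; elim/big_ind: _ => [|Y Z [g <-] [g' <-]|i _].
  - by exists 1; apply: rmorph1.
  - by exists (g * g'); apply: rmorphM.
  - by have [g <-] := adjoin_var i; exists (g ^+ m i); apply: rmorphXn.
exists (c%:MP%:P * g + h).
by rewrite rmorphD rmorphM adjoinC mwidenC Eg mul_mpolyC.
Qed.

Variables (a : 'I_n -> A) (xi : A).

Definition extend_point (i : 'I_n.+1) : A := oapp a xi (unlift ord_max i).

Let extend_widen i : extend_point (widen_ord (leqnSn n) i) = a i.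
Proof.
rewrite /extend_point.
suff -> : widen_ord (leqnSn n) i = lift ord_max i by rewrite liftK.
by apply: val_inj; rewrite /= /bump leqNgt ltn_ord.
Qed.

Let extend_max : extend_point ord_max = xi.
Proof. by rewrite /extend_point unlift_none. Qed.

Lemma meval_mwiden c : (mwiden c).@[extend_point] = c.@[a].
Proof.
elim/mpolyind: c => [|c m P _ _ IH]; first by rewrite mwiden0 !meval0.
rewrite mwidenD mwidenZ mwidenX !mevalD !mevalZ IH; congr (_ * _ + _).
rewrite !mevalX big_ord_recr /= mnmwiden_ordmax expr0 mulr1.
by apply: eq_bigr => i _; rewrite extend_widen mnmwiden_widen.
Qed.

Lemma meval_adjoin (h : {poly {mpoly A[n]}}) :
  (mpoly_adjoin h).@[extend_point] = (map_poly (meval a) h).[xi].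
Proof.
elim/poly_ind: h => [|h c IH]; first by rewrite !rmorph0 horner0.
rewrite rmorphD rmorphM adjoinX adjoinC mevalD mevalM IH mevalXU.
rewrite rmorphD rmorphM /= map_polyX map_polyC !hornerE.
by rewrite extend_max meval_mwiden.
Qed.

End AdjoinVariable.

Lemma prime_ideal_preim (R S : comNzRingType) (f : {rmorphism R -> S}) p :
  prime_ideal p -> prime_ideal (fun x => p (f x)).
Proof.
case=> [[p0 pD pM] np1 pP]; split; [split| |].
- by rewrite rmorph0.
- by move=> x y; rewrite rmorphD; apply: pD.
- by move=> b x; rewrite rmorphM; apply: pM.
- by rewrite rmorph1.
- by move=> x y; rewrite rmorphM; apply: pP.
Qed.

Lemma prime_ideal_zero n (p : {mpoly A[n]} -> Prop) g : alg_closed_field A ->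
  prime_ideal p -> ~ p g -> exists2 a, zeroset p a & g.@[a] != 0.
Proof.
move=> acA; elim: n p g => [|n IHn] p g prime_p npg.
  (* Without variables all polynomials are constant, and a proper ideal contains no unit. *)
  have pC c : p c%:MP -> c = 0.
    move=> pc; apply: contrapT => /eqP c0; case: acA => fA _.
    have [d cd] := fA c c0; case: prime_p => [[_ _ pM]] np1 _; apply: np1.
    by rewrite -mpolyC1 -cd mulrC mpolyCM; apply: pM.
  have mC (P : {mpoly A[0]}) : P = (P.@[fun _ => 0])%:MP.
    elim/mpolyind: P => [|c m P _ _ IH]; first by rewrite meval0 mpolyC0.
    rewrite mevalD mevalZ mpolyCD -IH; congr (_ + _).
    have -> : m = 0%MM by apply/mnmP => -[].
    by rewrite mpolyX0 meval1 mulr1 alg_mpolyC.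
  exists (fun _ => 0); first by move=> P; rewrite [P]mC => /pC->; rewrite meval0.
  apply: contra_notN npg => /eqP g0; rewrite [g]mC g0 mpolyC0.
  by case: prime_p => -[].
have prime_p' := prime_ideal_preim (mpoly_adjoin n) prime_p.
have [g' Eg] := mpoly_adjoin_surj g.
have [|c npc spec] := prime_poly_specialization prime_p' (g := g').
  by rewrite Eg.
(* The contraction of [p] to the first [n] variables has, by induction, a zero [a] where [c] does
   not vanish; [spec] then supplies the last coordinate. *)
have prime_q := prime_ideal_preim (polyC : {rmorphism _ -> _}) prime_p'.
have [a za ca] := IHn _ c prime_q npc.
have [xi zxi gxi] := spec A (meval a) acA za ca.
exists (extend_point a xi); last by rewrite -Eg meval_adjoin.
move=> P; have [h <-] := mpoly_adjoin_surj P => ph.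
by rewrite meval_adjoin; apply: zxi.
Qed.

Lemma alg_closed_nullstellensatz n (I : {mpoly A[n]} -> Prop) :
  alg_closed_field A -> is_ideal I -> nullstellensatz_for I.
Proof.
move=> acA idI P; split=> [vP|[k Pk] a za].
  apply: contrapT => nradP.
  have [p [prime_p Ip npP]] := exists_prime_avoiding idI nradP.
  have [a za /eqP[]] := prime_ideal_zero acA prime_p npP.
  by apply: vP => Q /Ip; apply: za.
apply/eqP; apply/negPn/negP => Pa; have /eqP := za _ Pk.
by rewrite rmorphXn; apply/negP; apply: is_field_expf_neq0 => //; case: acA.
Qed.

End Nullstellensatz.

(** * Positive existential sentences and polynomial systems *)

Section PositiveFormulas.

Variables (A : comNzRingType) (k : nat).

Fixpoint mpoly_of_pterm (t : pterm A k) : {mpoly A[k]} :=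
  match t with
  | PVar i => 'X_i
  | PConst c => c%:MP
  | PZero => 0
  | POne => 1
  | PAdd t u => mpoly_of_pterm t + mpoly_of_pterm u
  | PSub t u => mpoly_of_pterm t - mpoly_of_pterm u
  | PMul t u => mpoly_of_pterm t * mpoly_of_pterm u
  end.

Lemma mmap_mpoly_of_pterm (B : comNzRingType) (f : {rmorphism A -> B}) e t :
  mmap f e (mpoly_of_pterm t) = eval_pterm f e t.
Proof.
elim: t => [i|c|||t IHt u IHu|t IHt u IHu|t IHt u IHu] /=.
- by rewrite mmapX mmap1U.
- by rewrite mmapC.
- by rewrite rmorph0.
- by rewrite rmorph1.
- by rewrite rmorphD /= IHt IHu.
- by rewrite rmorphB /= IHt IHu.
- by rewrite rmorphM /= IHt IHu.
Qed.

(** The system depends on [e]: equations become differences, conjunctions concatenate systems, and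
    of a disjunction only a disjunct true at [e] is kept. *)
Lemma pform_equations (B : comNzRingType) (f : {rmorphism A -> B}) e
    (phi : pform A k) : holds_pform f e phi ->
  exists s : seq {mpoly A[k]}, (forall P, P \in s -> mmap f e P = 0) /\
    forall a, (forall P, P \in s -> P.@[a] = 0) -> holds_pform idfun a phi.
Proof.
elim: phi => [|//|t u|phi IHphi psi IHpsi|phi IHphi psi IHpsi] /=.
- by exists [::].
- move=> tu; exists [:: mpoly_of_pterm t - mpoly_of_pterm u]; split=> [P|a sa].
    by rewrite inE => /eqP->; rewrite rmorphB /= !mmap_mpoly_of_pterm tu subrr.
  apply/eqP; rewrite -subr_eq0 -!(mmap_mpoly_of_pterm idfun) -rmorphB.
  by apply/eqP/sa; rewrite inE.
- case=> /IHphi[s [sB sA]] /IHpsi[r [rB rA]]; exists (s ++ r); split=> [P|a sra].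
    by rewrite mem_cat => /orP[/sB|/rB].
  by split; [apply: sA|apply: rA] => P Ps; apply: sra; rewrite mem_cat Ps ?orbT.
- case=> [/IHphi|/IHpsi] [s [sB sA]]; exists s; split=> // a /sA; by [left|right].
Qed.

End PositiveFormulas.

Definition generated_ideal (R : comNzRingType) (s : seq R) : R -> Prop :=
  fun x => exists c : 'I_(size s) -> R, x = \sum_(i < size s) c i * s`_i.

Lemma generated_idealP (R : comNzRingType) (s : seq R) :
  is_ideal (generated_ideal s).
Proof.
split.
- by exists (fun _ => 0); rewrite big1 // => i _; rewrite mul0r.
- move=> _ _ [c ->] [d ->]; exists (fun i => c i + d i).
  by rewrite -big_split; apply: eq_bigr => i _; rewrite mulrDl.
- move=> a _ [c ->]; exists (fun i => a * c i).
  by rewrite mulr_sumr; apply: eq_bigr => i _; rewrite mulrA.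
Qed.

Lemma mem_generated_ideal (R : comNzRingType) (s : seq R) x :
  x \in s -> generated_ideal s x.
Proof.
move=> xs; have ltxs : (index x s < size s)%N by rewrite index_mem.
exists (fun i => (i == Ordinal ltxs)%:R).
rewrite (bigD1 (Ordinal ltxs)) //= eqxx mul1r nth_index // big1 ?addr0 //.
by move=> i /negPf->; rewrite mul0r.
Qed.

Lemma nullstellensatz_pec (A : comNzRingType) :
  (forall (n : nat) (I : {mpoly A[n]} -> Prop),
     is_ideal I -> fin_gen_ideal I -> nullstellensatz_for I) ->
  pec_nontrivial A.
Proof.
move=> nsA B f k phi [e /pform_equations[s [sB sA]]].
apply: contrapT => nsat.
(* If the system has no zero in [A], the polynomial 1 vanishes on its empty zero set. *)
have [|vr _] := nsA k _ (generated_idealP s) _ 1; first by exists s.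
have [|m] := vr.
  move=> a za; case: nsat; exists a; apply: sA => P Ps.
  by apply: za; apply: mem_generated_ideal.
(* Evaluating at [e] the expression of 1 as a combination of [s] gives [1 = 0] in [B]. *)
rewrite expr1n => -[c /(congr1 (mmap f e))].
rewrite rmorph1 rmorph_sum big1 => [/eqP|i _]; first by rewrite oner_eq0.
by rewrite rmorphM /= [mmap f e s`_i]sB ?mulr0 ?mem_nth.
Qed.

(** * From positive existential closedness to algebraically closed fields *)

Definition principal_ideal (R : comNzRingType) (x : R) : R -> Prop :=
  fun y => exists z, y = z * x.

Lemma principal_idealP (R : comNzRingType) (x : R) :
  is_ideal (principal_ideal x).
Proof.
split.
- by exists 0; rewrite mul0r.
- by move=> _ _ [y ->] [z ->]; exists (y + z); rewrite mulrDl.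
- by move=> a _ [y ->]; exists (a * y); rewrite mulrA.
Qed.

Lemma principal_ideal_quotient (R : comNzRingType) (x : R) :
  ~ (exists y, 1 = y * x) ->
  exists (B : comNzRingType) (f : {rmorphism R -> B}), f x = 0.
Proof.
move=> /(exists_quotient_ring (principal_idealP x)) [B [f fI]].
by exists B, f; apply: fI; exists 1; rewrite mul1r.
Qed.

Lemma pec_is_field (A : comNzRingType) : pec_nontrivial A -> is_field A.
Proof.
move=> pecA x x0; apply: contrapT => nx.
have [|B [f fx]] := @principal_ideal_quotient A x.
  by case=> y xy; apply: nx; exists y; rewrite mulrC.
have [|_ /= /eqP] := pecA B f 0%N (PEq (PConst _ x) (PZero _ _)).
  by exists (fun _ => 0).
exact/negP.
Qed.

(** Horner's scheme, so that evaluation follows the recursion of [horner]. *)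
Definition pterm_of_poly (A : comNzRingType) (p : {poly A}) : pterm A 1 :=
  foldr (fun c t => PAdd (PMul t (PVar _ ord0)) (PConst _ c)) (PZero _ _) p.

Lemma eval_pterm_of_poly (A B : comNzRingType) (f : {rmorphism A -> B}) e p :
  eval_pterm f e (pterm_of_poly p) = (map_poly f p).[e ord0].
Proof.
rewrite map_polyE horner_Poly /pterm_of_poly.
by elim: (polyseq p) => //= c s ->.
Qed.

Lemma pec_alg_closed (A : comNzRingType) : pec_nontrivial A -> alg_closed A.
Proof.
move=> pecA p sp; have fA := pec_is_field pecA.
have p0 : p != 0 by rewrite -size_poly_gt0 ltnW.
have [|B [f fp]] := @principal_ideal_quotient {poly A} p.
  case=> q qp; have q0 : q != 0.
    by apply: contra_eq_neq qp => ->; rewrite mul0r oner_neq0.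
  (* Over a field degrees add, so no multiple of the non-constant [p] equals 1. *)
  have := @size_proper_mul _ q p; rewrite -qp size_poly1.
  rewrite is_field_mulf_neq0 ?lead_coef_eq0 // => /(_ isT).
  move: q0 sp; rewrite -size_poly_gt0.
  by case: (size q) (size p) => [|a] [|[|b]] //; rewrite !addnS addSn.
have [|e /=] := pecA B (f \o polyC) 1%N (PEq (pterm_of_poly p) (PZero _ _)).
  (* The image of the indeterminate is a root in [B], since [p] evaluated there is [f p]. *)
  exists (fun _ => f 'X); rewrite /= eval_pterm_of_poly map_poly_comp.
  by rewrite horner_map /= -/(comp_poly _ _) comp_polyXr.
rewrite eval_pterm_of_poly map_poly_id // => pe.
by exists (e ord0); apply/rootP.
Qed.

Theorem theorem4p2 (A : comNzRingType) :
  [<-> alg_closed_field A;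
       forall (n : nat) (I : {mpoly A[n]} -> Prop),
         is_ideal I -> nullstellensatz_for I;
       forall (n : nat) (I : {mpoly A[n]} -> Prop),
         is_ideal I -> fin_gen_ideal I -> nullstellensatz_for I;
       pec_nontrivial A].
Proof.
tfae.
- by move=> acA n I; apply: alg_closed_nullstellensatz.
- by move=> nsA n I idI _; apply: nsA.
- exact: nullstellensatz_pec.
- by move=> pecA; split; [apply: pec_is_field|apply: pec_alg_closed].
Qed.
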